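(* Let $X$ be a complete separable metric space without isolated points. Then the collection of all sets $K\in\mathcal{K}(X)$ which are attractors of some weakly contractive iterated function system on $X$ is of the first Baire category (meager) in $(\mathcal{K}(X),d_H)$.
   Context: $\mathcal{K}(X)$ is the set of nonempty compact subsets of $X$ with the Hausdorff metric $d_H$. An IFS on $X$ is a finite family $\mathcal{F}=\{w_1,\dots,w_N\}$ of maps $w_i:X\to X$; for continuous $w_i$ its Hutchinson operator is $\mathcal{F}(K)=\bigcup_{i=1}^N w_i(K)$, $K\in\mathcal{K}(X)$. An attractor of $\mathcal{F}$ is a set $A\in\mathcal{K}(X)$ with $\mathcal{F}(A)=A$ and $\mathcal{F}^k(K)\to A$ in $d_H$ for every $K\in\mathcal{K}(X)$. An IFS is weakly contractive if it consists of Banach contractions, or of Rakotch contractions, or of Browder contractions, or of Edelstein contractions. Here $f:X\to X$ is: a Banach contraction if $\operatorname{Lip}(f)<1$; a Rakotch contraction if $d(f(x),f(y))\le\lambda(d(x,y))d(x,y)$ for some nonincreasing $\lambda:[0,\infty)\to[0,1]$ with $\lambda(t)<1$ for $t>0$; a Browder contraction if $d(f(x),f(y))\le\varphi(d(x,y))$ for some nondecreasing right continuous $\varphi:[0,\infty)\to[0,\infty)$ with $\varphi(t)<t$ for $t>0$; an Edelstein contraction if $d(f(x),f(y))<d(x,y)$ for all $x\ne y$. (Each of the first three classes is contained in the class of Edelstein contractions.) *)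

(* Defs.v *)
From HB Require Import structures.
From mathcomp Require Import all_boot all_order all_algebra.
From mathcomp Require Import all_classical all_reals all_analysis.

Set Implicit Arguments.
Unset Strict Implicit.
Unset Printing Implicit Defensive.

Import Order.TTheory GRing.Theory Num.Theory.
Import numFieldNormedType.Exports.

Local Open Scope classical_set_scope.
Local Open Scope ring_scope.

(* [completeType] requires a distinguished point; this predicate does not, so
   it also covers the empty space. *)
Definition complete_space (T : uniformType) : Prop :=
  forall F : set_system T, ProperFilter F -> cauchy F -> exists l : T, F --> l.

Definition separable_space (T : topologicalType) : Prop :=
  exists2 D : set T, countable D & dense D.

Definition nowhere_dense (T : topologicalType) (A : set T) : Prop :=
  interior (closure A) = set0.

Definition meager (T : topologicalType) (A : set T) : Prop :=
  exists2 F : nat -> set T,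
    (forall n, nowhere_dense (F n)) & A = \bigcup_n F n.

Section Hyperspace.
Context {R : realType} (X : metricType R).

Record hyperspace : Type := Hyperspace {
  hset :> set X ;
  hset_neq0 : hset !=set0 ;
  hset_compact : compact hset
}.

HB.instance Definition _ := gen_eqMixin hyperspace.
HB.instance Definition _ := gen_choiceMixin hyperspace.

Lemma hyperspace_eq (A B : hyperspace) : (A : set X) = B -> A = B.
Proof.
case: A B => [A A0 cA] [B B0 cB] /= AB; subst B.
by rewrite (Prop_irrelevance A0 B0) (Prop_irrelevance cA cB).
Qed.

Definition dist_set (x : X) (B : set X) : R := inf [set mdist x b | b in B].

Definition excess (A B : set X) : R := sup [set dist_set a B | a in A].

Definition hausdorff_dist (A B : hyperspace) : R :=
  Num.max (excess A B) (excess B A).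

Lemma dist_set_has_inf x (B : hyperspace) :
  has_inf [set mdist x b | b in (B : set X)].
Proof.
split; first by have [b Bb] := hset_neq0 B; exists (mdist x b), b.
by exists 0 => _ [b _ <-]; exact: mdist_ge0.
Qed.

Lemma dist_set_le x (B : hyperspace) b : hset B b -> dist_set x B <= mdist x b.
Proof.
move=> Bb; apply: ge_inf; last by exists b.
by case: (dist_set_has_inf x B).
Qed.

Lemma dist_set_ge0 x (B : hyperspace) : 0 <= dist_set x B.
Proof.
apply: lb_le_inf; first by case: (dist_set_has_inf x B).
by move=> _ [b _ <-]; exact: mdist_ge0.
Qed.

Lemma hyperspace_bounded (A : hyperspace) (x : X) :
  exists M, forall a, hset A a -> mdist x a <= M.
Proof.
have /compact_near_coveringP cA := @hset_compact A.
have : \forall M \near +oo, (A : set X) `<=` (fun a => mdist x a <= M).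
  apply: (cA _ _ (fun M a => mdist x a <= M)) => a Aa.
  exists (ball a 1, [set M | mdist x a + 1 <= M]) => /=.
    by split; [exact: nbhsx_ballx | apply: nbhs_pinfty_ge; exact: num_real].
  move=> [b M] /= [ab]; apply: le_trans.
  apply: (le_trans (metric_triangle _ a _)); rewrite lerD2l ltW//.
  by move: ab; rewrite ballEmdist.
by move=> /filter_ex[M AM]; exists M.
Qed.

Lemma excess_has_sup (A B : hyperspace) :
  has_sup [set dist_set a B | a in (A : set X)].
Proof.
split; first by have [a Aa] := hset_neq0 A; exists (dist_set a B), a.
have [b Bb] := hset_neq0 B; have [M AM] := hyperspace_bounded A b.
exists M => _ [a Aa <-]; apply: le_trans (AM _ Aa).
by rewrite metric_sym; exact: dist_set_le.
Qed.

Lemma excess_leP (A B : hyperspace) (r : R) :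
  excess A B <= r <->
  forall a e, hset A a -> 0 < e -> exists2 b, hset B b & mdist a b < r + e.
Proof.
split=> [ABr a e Aa e0|H].
  have [_ [b Bb <-] lt_b] := inf_adherent e0 (dist_set_has_inf a B).
  exists b => //; apply: (lt_le_trans lt_b); rewrite lerD2r.
  apply: le_trans ABr; apply: ub_le_sup; last by exists a.
  by case: (excess_has_sup A B).
apply: ge_sup; first by case: (excess_has_sup A B).
move=> _ [a Aa <-]; apply/ler_addgt0Pr => e e0.
have [b Bb ltb] := H a e Aa e0.
exact: le_trans (dist_set_le _ Bb) (ltW ltb).
Qed.

Lemma excess_ge0 (A B : hyperspace) : 0 <= excess A B.
Proof.
have [a Aa] := hset_neq0 A; apply: le_trans (dist_set_ge0 a B) _.
apply: ub_le_sup; last by exists a.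
by case: (excess_has_sup A B).
Qed.

Lemma excess_self (A : hyperspace) : excess A A = 0.
Proof.
apply/eqP; rewrite eq_le excess_ge0 andbT; apply/excess_leP => a e Aa e0.
by exists a => //; rewrite mdistxx add0r.
Qed.

Lemma excess_triangle (A B C : hyperspace) :
  excess A C <= excess A B + excess B C.
Proof.
apply/excess_leP => a e Aa e0; have e20 : 0 < e / 2 by rewrite divr_gt0.
have [b Bb ab] := (excess_leP A B _).1 (lexx _) a _ Aa e20.
have [c Cc bc] := (excess_leP B C _).1 (lexx _) b _ Bb e20.
exists c => //; apply: (le_lt_trans (metric_triangle _ b _)).
by rewrite [e in ltRHS]splitr addrACA ltrD.
Qed.

Lemma excess0_subset (A B : hyperspace) :
  excess A B <= 0 -> (A : set X) `<=` B.
Proof.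
move=> /excess_leP AB a Aa.
have : closed (B : set X).
  by apply: compact_closed; [exact: metric_hausdorff | exact: hset_compact].
apply=> U /nbhs_ballP[e /= e0 aeU].
have [b Bb ab] := AB a e Aa e0; exists b; split=> //; apply: aeU.
by rewrite ballEmdist /=; rewrite add0r in ab.
Qed.

Lemma hausdorff_distxx A : hausdorff_dist A A = 0.
Proof. by rewrite /hausdorff_dist excess_self maxxx. Qed.

Lemma hausdorff_dist_positivity A B : hausdorff_dist A B = 0 -> A = B.
Proof.
move=> AB0; have : hausdorff_dist A B <= 0 by rewrite AB0.
rewrite /hausdorff_dist ge_max => /andP[AB BA].
by apply/hyperspace_eq/seteqP; split; exact: excess0_subset.
Qed.

Lemma hausdorff_dist_sym A B : hausdorff_dist A B = hausdorff_dist B A.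
Proof. by rewrite /hausdorff_dist maxC. Qed.

Lemma hausdorff_dist_triangle B A C :
  hausdorff_dist A C <= hausdorff_dist A B + hausdorff_dist B C.
Proof.
rewrite {1}/hausdorff_dist ge_max; apply/andP; split.
  apply: le_trans (excess_triangle A B C) _.
  by apply: lerD; rewrite /hausdorff_dist le_max lexx.
apply: le_trans (excess_triangle C B A) _; rewrite addrC.
by apply: lerD; rewrite /hausdorff_dist le_max lexx orbT.
Qed.

HB.instance Definition _ := isMetric.Build R hyperspace
  hausdorff_distxx hausdorff_dist_positivity hausdorff_dist_sym
  hausdorff_dist_triangle.

End Hyperspace.

Section Contractions.
Context {R : realType} {X : metricType R}.
Implicit Type f : X -> X.

(* The least Lipschitz constant of [f], [+oo] if [f] is not Lipschitz. *)
Definition Lip f : \bar R :=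
  ereal_inf [set L%:E | L in
    [set L : R | 0 <= L /\ forall x y, mdist (f x) (f y) <= L * mdist x y]].

Definition banach_contraction f : Prop := (Lip f < 1)%E.

(* Functions on [0, +oo[ are represented by functions on R of which only the
   values on [0, +oo[ are constrained. *)
Definition rakotch_contraction f : Prop :=
  exists lambda : R -> R,
    [/\ forall t, 0 <= t -> 0 <= lambda t <= 1,
        forall s t, 0 <= s -> s <= t -> lambda t <= lambda s,
        forall t, 0 < t -> lambda t < 1 &
        forall x y, mdist (f x) (f y) <= lambda (mdist x y) * mdist x y].

Definition browder_contraction f : Prop :=
  exists phi : R -> R,
    [/\ forall t, 0 <= t -> 0 <= phi t,
        forall s t, 0 <= s -> s <= t -> phi s <= phi t,
        forall t, 0 <= t -> phi s @[s --> t^'+] --> phi t,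
        forall t, 0 < t -> phi t < t &
        forall x y, mdist (f x) (f y) <= phi (mdist x y)].

Definition edelstein_contraction f : Prop :=
  forall x y, x <> y -> mdist (f x) (f y) < mdist x y.

End Contractions.

Section IFS.
Context {R : realType} {X : metricType R} {n : nat}.

(* An IFS with n + 1 maps: the index type ['I_n.+1] makes the family nonempty. *)
Definition weakly_contractive (w : 'I_n.+1 -> X -> X) : Prop :=
  [\/ forall i, banach_contraction (w i),
      forall i, rakotch_contraction (w i),
      forall i, browder_contraction (w i) |
      forall i, edelstein_contraction (w i)].

Definition hutchinson_set (w : 'I_n.+1 -> X -> X) (K : set X) : set X :=
  \bigcup_i (w i @` K).

Lemma hutchinson_neq0 w (K : hyperspace X) : hutchinson_set w K !=set0.
Proof. by have [x Kx] := hset_neq0 K; exists (w ord0 x), ord0 => //; exists x. Qed.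

Lemma hutchinson_compact w (K : hyperspace X) :
  (forall i, continuous (w i)) -> compact (hutchinson_set w K).
Proof.
move=> cw; rewrite /hutchinson_set.
rewrite (_ : \bigcup_i _ = \big[setU/set0]_(i < n.+1) (w i @` K)).
  apply: bigsetU_compact => i _; apply: continuous_compact.
    by apply: continuous_subspaceT => x; exact: cw.
  exact: hset_compact.
apply/seteqP; split=> x.
  by move=> [i _ wiKx]; rewrite (bigD1 i) //=; left.
by elim/big_rec: _ => // i S _ IH [wiKx|/IH//]; exists i.
Qed.

Definition hutchinson (w : 'I_n.+1 -> X -> X)
    (cw : forall i, continuous (w i)) (K : hyperspace X) : hyperspace X :=
  Hyperspace (@hutchinson_neq0 w K) (@hutchinson_compact w K cw).

(* The Hutchinson operator acts on K(X) only if the maps are continuous, which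
   all weakly contractive maps are. *)
Definition is_attractor (w : 'I_n.+1 -> X -> X) (A : hyperspace X) : Prop :=
  exists cw : forall i, continuous (w i),
    hutchinson cw A = A /\
    forall K : hyperspace X, iter k (hutchinson cw) K @[k --> \oo] --> A.

End IFS.

(* Main.v *)
(* Each of the four classes consists of Edelstein maps, and on a compact set such
   maps shrink distances at least [eta] by at least some [eps > 0]. Fix the number
   [N] of maps, [eta] and [eps], and consider the compact sets containing [N + 1]
   points at mutual distance at least [2 eta] and covered by their images under [N]
   maps with these constants. Replace such a set [K] by a finite net containing
   these points, and successively surround each of them by a cluster, each much
   tighter than the previous ones and with more than [N] times as many points as
   the finite set built so far. In all sets close to the result, no cluster is
   covered by the images of its complement. Since a map cannot send two of the
   clusters to themselves, some cluster is met by none of its own images; hence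
   none of these sets belongs to the class, which is therefore nowhere dense.
   Finite attractors are handled by the same clusters. *)

Require Import Defs.
From mathcomp Require Import all_boot all_order all_algebra.
From mathcomp Require Import all_classical all_reals all_analysis.
From mathcomp Require Import lra.

Set Implicit Arguments.
Unset Strict Implicit.
Unset Printing Implicit Defensive.

Import Order.TTheory GRing.Theory Num.Theory.

Local Open Scope classical_set_scope.
Local Open Scope ring_scope.

(** * Finite sets, finite nets and nowhere density in the hyperspace *)

Lemma seq_pos_lower_bound (R : realType) (T : eqType) (s : seq T) (g : T -> R) :
  {in s, forall x, 0 < g x} ->
  exists2 m, 0 < m & {in s, forall x, m <= g x}.
Proof.
elim: s => [|x s IH] gpos; first by exists 1.
have [y ys|m m0 ms] := IH; first by apply: gpos; rewrite inE ys orbT.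
have gx : 0 < g x by apply: gpos; rewrite mem_head.
exists (Num.min m (g x)); first by rewrite lt_min m0.
move=> y; rewrite inE => /orP[/eqP->|/ms my]; first by rewrite ge_min lexx orbT.
by rewrite ge_min my.
Qed.

Section FiniteSets.
Context {R : realType} {X : metricType R}.
Implicit Types (x y z : X) (A B C K : set X) (F s t : seq X) (e r d : R).

Definition separated r s := {in s &, forall x y, x != y -> r <= mdist x y}.

(** Hausdorff closeness of arbitrary sets, so that a list can be used without being packed as a
    [hyperspace]. *)
Definition hnear r A B :=
  (forall a, A a -> exists2 b, B b & mdist a b < r) /\
  (forall b, B b -> exists2 a, A a & mdist a b < r).

(* By pigeonhole, [N] nonexpansive maps cannot cover [K `&` ball x r] by the
   images of the rest of [K]: two points of [s] would come from a single map and
   a single small ball centred in [t]. *)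
Definition crowded (N : nat) x r K :=
  exists s t h, [/\ uniq s, (0 < size t)%N & (N * size t < size s)%N] /\
    [/\ {in s, forall y, K y /\ mdist x y < r}, separated h s &
        forall u, K u -> r <= mdist x u -> exists2 z, z \in t & mdist z u < h / 2].

Lemma separated_exists s : exists2 r, 0 < r & separated r s.
Proof.
have [[x y]|r r0 rs] := @seq_pos_lower_bound R _
    [seq p <- [seq (x, y) | x <- s, y <- s] | p.1 != p.2] (fun p => mdist p.1 p.2).
  by rewrite mem_filter mdist_gt0 => /andP[].
exists r => // x y xs ys xy; apply: (rs (x, y)).
by rewrite mem_filter xy; apply/allpairsP; exists (x, y).
Qed.

Lemma hnear_trans r d A B C : hnear r A B -> hnear d B C -> hnear (r + d) A C.
Proof.
move=> [AB BA] [BC CB]; split=> [a /AB[b /BC[c Cc bc] ab]|c /CB[b /BA[a Aa ab] bc]].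
  by exists c => //; have := metric_triangle a b c; lra.
by exists a => //; have := metric_triangle a b c; lra.
Qed.

Lemma hnearW r d A B : r <= d -> hnear r A B -> hnear d A B.
Proof.
move=> rd [AB BA]; split=> [a /AB[b Bb ab]|b /BA[a Aa ab]].
  by exists b => //; exact: lt_le_trans ab rd.
by exists a => //; exact: lt_le_trans ab rd.
Qed.

Lemma near_finite_net (K : hyperspace X) s e : {in s, forall x : X, hset K x} ->
  0 < e -> exists2 F : seq X, {subset s <= F} & hnear e K [set` F].
Proof.
move=> sK e0; have [F FK FP] : exists2 F : seq X, {in F, forall x : X, hset K x} &
    forall x, hset K x -> exists2 y : X, y \in F & mdist x y < e.
  apply: contrapT => noF.
  have step F : {in F, forall x : X, hset K x} ->
      exists2 x : X, hset K x & {in F, forall y, e <= mdist x y}.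
    move=> FK; apply: contrapT => nox; apply: noF; exists F => // x Kx.
    apply: contrapT => noy; apply: nox; exists x => // y yF.
    by rewrite leNgt; apply/negP => xy; apply: noy; exists y.
  move: (@hset_compact _ _ K) => /compact_near_coveringP cK.
  pose P F x := exists2 y : X, y \in F & mdist x y < e.
  (* Filter of the families that contain all large enough lists in [K]; compactness then yields one
     list serving all points. *)
  have /= := cK (seq X) [set S | exists F0, {in F0, forall x : X, hset K x} /\
    forall F, {in F, forall x : X, hset K x} -> {subset F0 <= F} -> S F] P.
  set FF := [set S | _].
  have fFF : Filter FF.
    split; first by exists [::]; split.
      move=> S T [F0 [K0 S0]] [F1 [K1 T1]]; exists (F0 ++ F1); split.
        by move=> x; rewrite mem_cat => /orP[/K0|/K1].
      move=> F FK sF; split; [apply: S0|apply: T1] => // x xF; apply: sF;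
        by rewrite mem_cat xF ?orbT.
    move=> S T ST [F0 [K0 S0]]; exists F0; split=> // F FK sF; apply: ST.
    exact: S0.
  have [x Kx|F0 [K0 /(_ F0 K0 (fun _ => id)) F0P]] := cK _ FF P fFF.
    exists (ball x (e / 2), [set F | x \in F]) => /=.
      split; first by apply: nbhsx_ballx; lra.
      exists [:: x]; split=> [y|F FK]; first by rewrite inE => /eqP->.
      by apply; rewrite mem_head.
    move=> [y F] [/=]; rewrite ballEmdist /= => xy xF; exists x => //.
    by rewrite metric_sym; lra.
  have [x Kx xF] := step _ K0.
  by have [y /xF] := F0P x Kx; rewrite leNgt => /negP.
exists (s ++ F); first by move=> x; rewrite mem_cat => ->.
split=> [x /FP[y yF xy]|y /=]; first by exists y; rewrite //= mem_cat yF orbT.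
rewrite mem_cat => yF; exists y; last by rewrite mdistxx.
by case/orP: yF; [exact: sK | exact: FK].
Qed.

Lemma hausdorff_hnear (A B : hyperspace X) r :
  hausdorff_dist A B < r -> hnear r A B.
Proof.
rewrite /hausdorff_dist gt_max => /andP[AB BA].
split=> [a Aa|b Bb].
  have /excess_leP/(_ a (r - excess A B) Aa) := lexx (excess A B).
  by rewrite subr_gt0 subrKC; apply.
have /excess_leP/(_ b (r - excess B A) Bb) := lexx (excess B A).
rewrite subr_gt0 subrKC => /(_ BA)[a Aa ab]; exists a => //.
by rewrite metric_sym.
Qed.

Lemma hnear_hausdorff (A B : hyperspace X) r :
  hnear r A B -> hausdorff_dist A B <= r.
Proof.
move=> [AB BA]; rewrite /hausdorff_dist ge_max; apply/andP; split.
  apply/excess_leP => a e /AB[b Bb ab] e0; exists b => //; lra.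
apply/excess_leP => b e /BA[a Aa ab] e0; exists a => //.
by rewrite metric_sym; lra.
Qed.

(** A ball in the closure of [S] would contain a member [K], then a finite [F] near [K], and [F]
    would be a limit of members of [S]. *)
Lemma nowhere_dense_hyperspace (S : set (hyperspace X)) :
  (forall (K : hyperspace X) e, S K -> 0 < e -> exists (F : seq X) (d : R), [/\ F != [::], 0 < d,
      hnear e K [set` F] & forall L, S L -> ~ hnear d [set` F] (hset L)]) ->
  nowhere_dense S.
Proof.
move=> SP; rewrite /nowhere_dense -subset0 => K0 K0S.
have /nbhs_ballP[r /= r0 rS] : nbhs K0 (closure S) by [].
have := rS _ (ballxx _ r0).
have r20 : 0 < r / 2 by lra.
move=> /(_ _ (nbhsx_ballx K0 _ r20))[K [SK]]; rewrite ballEmdist /= => K0K.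
have r40 : 0 < r / 4 by lra.
have [F [d [F0 d0 KF noL]]] := SP K _ SK r40.
have F0' : [set` F] !=set0 by case: F F0 {KF noL} => // x F _; exists x; exact: mem_head.
pose FK := Hyperspace F0' (finite_compact (finite_seq F)).
have FS : closure S FK.
  apply: rS; rewrite ballEmdist /=; apply: le_lt_trans (metric_triangle _ K _) _.
  have : mdist K FK <= r / 4 by exact: hnear_hausdorff.
  lra.
have [L [SL]] := FS _ (nbhsx_ballx FK _ d0).
rewrite ballEmdist /= => /hausdorff_hnear; exact: noL.
Qed.

(** * Clusters around points of a finite set *)

Lemma perfect_ball_uniq x r n : isolated [set: X] = set0 -> 0 < r ->
  exists s, [/\ uniq s, size s = n & {in s, forall y, 0 < mdist x y < r}].
Proof.
move=> Xni r0; elim: n => [|n [s [us sn sx]]]; first by exists [::].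
have [|m m0 ms] := @seq_pos_lower_bound R _ s (mdist x).
  by move=> y /sx/andP[].
(* The new point is closer to [x] than all earlier ones, hence distinct from them; without one, [x]
   would be isolated. *)
have [y xy /andP[ym yr]] : exists2 y, x != y & (mdist x y < m) && (mdist x y < r).
  apply: contrapT => noy; have : isolated [set: X] x; last by rewrite Xni.
  split; first exact: in_setT.
  exists (ball x (Num.min m r)); first by apply: nbhsx_ballx; rewrite lt_min m0.
  rewrite setIT; apply/seteqP; split=> y /=; rewrite ballEmdist /=; last first.
    by move=> ->; rewrite mdistxx lt_min m0.
  rewrite lt_min => xym; apply: contrapT => /eqP yx.
  by apply: noy; exists y => //; rewrite eq_sym.
exists (y :: s); split=> [||z] /=; last 2 first.
- by rewrite sn.
- by rewrite inE => /orP[/eqP->|/sx//]; rewrite mdist_gt0 xy.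
rewrite us andbT; apply/negP => /ms; rewrite leNgt => /negP; exact.
Qed.

Lemma crowded_near (N : nat) F x r e : isolated [set: X] = set0 ->
  x \in F -> 0 < r -> 0 < e -> exists (F' : seq X) (d : R),
    [/\ {subset F <= F'}, hnear e [set` F] [set` F'], 0 < d &
        forall K, hnear d [set` F'] K -> crowded N x r K].
Proof.
move=> Xni xF r0 e0.
have [|S [uS sS Sx]] := @perfect_ball_uniq x (Num.min e (r / 2)) (N * size F).+1 Xni.
  by rewrite lt_min e0 divr_gt0.
have [m m0 Sm] := separated_exists S.
have m80 : 0 < m / 8 by lra.
have r20 : 0 < r / 2 by lra.
(* [m / 8] keeps points of [K] chosen near distinct points of [S] at least [m / 2] apart; [r / 2]
   keeps them in the ball and leaves only [F] near points outside it. *)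
exists (F ++ S), (Num.min (m / 8) (r / 2)); split.
- by move=> y; rewrite mem_cat => ->.
- split=> [y yF|y /=]; first by exists y; rewrite ?mdistxx //= mem_cat yF.
  rewrite mem_cat => /orP[yF|/Sx]; first by exists y; rewrite ?mdistxx.
  by rewrite lt_min => /and3P[_ ye _]; exists x.
- by rewrite lt_min m80.
move=> K [FK KF].
have /choice[g gP] : forall y, exists y', y \in S ->
    [/\ K y', mdist y y' < m / 8 & mdist y y' < r / 2].
  move=> y; have [yS|] := boolP (y \in S); last by exists y.
  have [|y' Ky'] := FK y; first by rewrite /= mem_cat yS orbT.
  by rewrite lt_min => /andP[? ?]; exists y'.
have gsep y z : y \in S -> z \in S -> y != z -> m / 2 <= mdist (g y) (g z).
  move=> yS zS yz; have [[_ dy _] [_ dz _]] := (gP y yS, gP z zS).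
  have := Sm _ _ yS zS yz; have := metric_triangle y (g y) z.
  have := metric_triangle (g y) (g z) z; rewrite (metric_sym (g z)); lra.
exists (map g S), F, (m / 2); split; split=> //.
- rewrite map_inj_in_uniq // => y z yS zS gyz; apply/eqP/negPn/negP => yz.
  by have := gsep _ _ yS zS yz; rewrite gyz mdistxx; lra.
- by case: F xF {sS FK KF}.
- by rewrite size_map sS.
- move=> _ /mapP[y yS ->]; have [Kg _ gr] := gP y yS; split=> //.
  have := Sx y yS; rewrite lt_min => /and3P[_ _ xy].
  have := metric_triangle x y (g y); lra.
- move=> _ _ /mapP[y yS ->] /mapP[z zS ->] gyz; apply: gsep => //.
  by apply: contra_neq gyz => ->.
move=> u /KF[z /=]; rewrite mem_cat lt_min => zFS /andP[zu zr] xu.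
exists z; last by lra.
case/orP: zFS => // /Sx; rewrite lt_min => /and3P[_ _ xz].
have := metric_triangle x z u; lra.
Qed.

Lemma crowded_near_seq (N : nat) F s r e : isolated [set: X] = set0 ->
  {subset s <= F} -> 0 < r -> 0 < e -> exists (F' : seq X) (d : R),
    [/\ {subset F <= F'}, hnear e [set` F] [set` F'], 0 < d &
        forall K, hnear d [set` F'] K -> {in s, forall x, crowded N x r K}].
Proof.
move=> Xni + r0; elim: s e => [|x s IH] e sF e0.
  exists F, 1; split=> //.
  by split=> y yF; exists y; rewrite ?mdistxx.
have e20 : 0 < e / 2 by lra.
have [|F1 [d1 [FF1 hF1 d10 K1]]] := IH _ _ e20.
  by move=> y ys; apply: sF; rewrite inE ys orbT.
(* The new cluster uses up half of the tolerance [d1] and leaves half for [K], so earlier crowding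
   persists. *)
have e' : 0 < Num.min (e / 2) (d1 / 2) by rewrite lt_min e20 divr_gt0.
have xF1 : x \in F1 by apply/FF1/sF/mem_head.
have [F2 [d2 [F12 hF2 d20 K2]]] := crowded_near N Xni xF1 r0 e'.
exists F2, (Num.min d2 (d1 / 2)); split.
- by move=> y /FF1/F12.
- rewrite [e]splitr; apply: hnear_trans hF1 (hnearW _ hF2).
  by rewrite ge_min lexx.
- by rewrite lt_min d20 divr_gt0.
move=> K hK y; rewrite inE => /orP[/eqP->|ys].
  by apply: K2; apply: hnearW hK; rewrite ge_min lexx.
apply: K1 => //; rewrite [d1]splitr; apply: hnear_trans (hnearW _ hF2) (hnearW _ hK).
  by rewrite ge_min lexx orbT.
by rewrite ge_min lexx orbT.
Qed.

End FiniteSets.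

(** * Pigeonhole and countable covers *)

Lemma pigeonhole (T U : eqType) (s : seq T) (t : seq U) (P : T -> U -> Prop) :
  uniq s -> (size t < size s)%N ->
  {in s, forall x, exists2 u, u \in t & P x u} ->
  exists x y u, [/\ x \in s, y \in s, x != y, P x u & P y u].
Proof.
move=> us ts sP; have [x0 x0s] : exists x0, x0 \in s.
  by case: s ts {us sP} => // x0 s _; exists x0; exact: mem_head.
have [u0 _ _] := sP x0 x0s.
have /choice[g gP] : forall x, exists u, x \in s -> u \in t /\ P x u.
  move=> x; have [xs|_] := boolP (x \in s); last by exists u0.
  have [u ut xu] := sP x xs.
  by exists u.
apply: contrapT => noxy; move: ts; rewrite ltnNge => /negP; apply.
rewrite -(size_map g); apply: uniq_leq_size => [|_ /mapP[x /gP[gt _] ->]//].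
rewrite map_inj_in_uniq // => x y xs ys gxy; apply/eqP/negPn/negP => xy.
by apply: noxy; exists x, y, (g x); split=> //; [case: (gP x xs)|rewrite gxy; case: (gP y ys)].
Qed.

(** [meager] asks for an equality and indices in [nat]: the sets are cut down to [A], and numbers
    that encode no index give the empty set. *)
Lemma meager_countable_cover (I : countType) (T : topologicalType)
    (G : I -> set T) (A : set T) :
  (forall i, nowhere_dense (G i)) -> A `<=` \bigcup_i G i -> meager A.
Proof.
move=> Gnd AG; have sub_nd B C : B `<=` C -> nowhere_dense C -> @nowhere_dense T B.
  rewrite /nowhere_dense -!subset0 => BC C0; apply: subset_trans C0.
  exact/interiorS/closureS.
exists (fun k => A `&` oapp G set0 (unpickle k)).
  move=> k; case: unpickle => [i|] /=; first by apply: sub_nd (Gnd i) => x [].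
  by rewrite setI0 /nowhere_dense closure0 interior0.
apply/seteqP; split=> [x Ax|x [k _ []]//].
have [i _ Gx] := AG x Ax; exists (pickle i) => //; split=> //.
by rewrite pickleK.
Qed.

(** * Uniform contraction on compact sets *)

Section WeakContractions.
Context {R : realType} {X : metricType R}.
Implicit Types (f : X -> X) (x y : X) (s : seq X).

Lemma weakly_contractive_edelstein n (w : 'I_n.+1 -> X -> X) :
  weakly_contractive w -> forall i, edelstein_contraction (w i).
Proof.
move=> cw i x y /eqP; rewrite -mdist_gt0 => xy; case: cw => /(_ i).
- move=> /ereal_inf_lt[_ [L [_ wL] <-]]; rewrite lte_fin => L1.
  by apply: le_lt_trans (wL x y) _; rewrite gtr_pMl.
- move=> [l [_ _ l1 wl]]; apply: le_lt_trans (wl x y) _.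
  by rewrite gtr_pMl // l1.
- move=> [phi [_ _ _ phit wphi]]; apply: le_lt_trans (wphi x y) _.
  exact: phit.
- by apply; apply/eqP; rewrite -mdist_gt0.
Qed.

(* On a compact set, Edelstein maps satisfy the last clause for every [eta] and
   some [eps] depending on it; countably many pairs [(eta, eps)] suffice. *)
Definition contractive_cover (N : nat) (eta eps : R) (K : set X) :=
  exists w : 'I_N -> X -> X, [/\ K `<=` \bigcup_i (w i @` K),
    forall i x y, K x -> K y -> mdist (w i x) (w i y) <= mdist x y &
    forall i x y, K x -> K y -> eta <= mdist x y ->
      mdist (w i x) (w i y) + eps <= mdist x y].

(** On the compact set of pairs at distance at least [eta], the loss of distance under each map is
    continuous and positive, hence bounded below; finitely many maps share a bound. *)
Lemma edelstein_gap n (w : 'I_n -> X -> X) (K : set X) (eta : R) :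
  (forall i, continuous (w i)) -> (forall i, edelstein_contraction (w i)) ->
  compact K -> 0 < eta -> exists q : nat, forall i x y, K x -> K y ->
    eta <= mdist x y -> mdist (w i x) (w i y) + q.+1%:R^-1 <= mdist x y.
Proof.
move=> cw ew cK eta0.
have : \forall e \near 0^'+, forall i, (K `*` K) `<=` [set p | eta <= mdist p.1 p.2 ->
    mdist (w i p.1) (w i p.2) + e <= mdist p.1 p.2].
  apply: filter_forall => i.
  move: (compact_setX cK cK) => /compact_near_coveringP cKK.
  apply: (cKK R _ (fun e p => eta <= mdist p.1 p.2 ->
    mdist (w i p.1) (w i p.2) + e <= mdist p.1 p.2)) => -[x y] _ /=.
  have [xy|xy] := ltP (mdist x y) eta.
    (* Pairs closer than [eta] stay so nearby, and the claim is vacuous. *)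
    pose r := (eta - mdist x y) / 2; have r0 : 0 < r by rewrite /r; lra.
    exists (ball x r `*` ball y r, setT) => /=.
      split; last exact: filterT.
      by exists (ball x r, ball y r) => //; split; exact: nbhsx_ballx.
    move=> [[u v] e] [/= + _]; rewrite !ballEmdist => -[/= xu yv].
    rewrite leNgt => /negP; case; have := metric_triangle u x v.
    by have := metric_triangle x y v; rewrite (metric_sym u x); move: xu yv; rewrite /r; lra.
  (* A fifth of the loss: moving both points and both images costs at most [4 r], which leaves
     [r >= e]. *)
  pose r := (mdist x y - mdist (w i x) (w i y)) / 5.
  have r0 : 0 < r.
    have /(ew i) : x <> y by apply/eqP; rewrite -mdist_gt0; lra.
    by rewrite /r; lra.
  have wn z : \forall u \near z, mdist (w i z) (w i u) < r /\ mdist z u < r.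
    near=> u; split; last first.
      have : ball z r u by near: u; exact: nbhsx_ballx.
      by rewrite ballEmdist.
    have : ball (w i z) r (w i u).
      near: u; apply: (cw i z); exact: nbhsx_ballx.
    by rewrite ballEmdist.
  exists ([set u | mdist (w i x) (w i u) < r /\ mdist x u < r] `*`
          [set v | mdist (w i y) (w i v) < r /\ mdist y v < r], [set e | e <= r]) => /=.
    split; last exact: nbhs_right_le.
    by eexists (_, _); [split; exact: wn|].
  move=> [[u v] e] [/= [[wu xu] [wv yv]] er] _.
  have := metric_triangle x u y; have := metric_triangle u v y.
  have := metric_triangle (w i u) (w i x) (w i v).
  have := metric_triangle (w i x) (w i y) (w i v).
  rewrite (metric_sym v y) (metric_sym (w i u) (w i x)); move: er wu xu wv yv; rewrite /r; lra.
move=> nearw; have : \forall e \near (0:R)^'+, 0 < e by exact: nbhs_right_gt.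
move=> /(filterI nearw)/filter_ex[e [we e0]].
have [q] := ltr_add_invr e0; rewrite add0r => qe.
exists q => i x y Kx Ky xy; apply: le_trans (we i (x, y) (conj Kx Ky) xy).
by rewrite lerD2l ltW.
Unshelve. all: by end_near.
Qed.

(* A map cannot send two of the balls to themselves, so some ball of [s] is
   covered by images of the complement of that ball. *)
Lemma contractive_cover_not_crowded N eta eps r K s :
  contractive_cover N eta eps K -> r <= eta / 2 -> r < eps / 4 ->
  uniq s -> (N < size s)%N -> separated (eta *+ 2) s ->
  ~ {in s, forall x, crowded N x r K}.
Proof.
move=> [w [Kw w1 weps]] reta reps us Ns sep crow.
(* Some map sends a point of the ball at [x] back into it. Otherwise all preimages of [s0] lie
   outside the ball, so two of them share a map and a centre in [t], and their images are closer
   than [h]. *)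
have recur : {in s, forall x, exists2 i, i \in enum 'I_N &
    exists2 u, K u & mdist x u < r /\ mdist x (w i u) < r}.
  move=> x /crow[s0 [t [h [[us0 t0 sz] [s0K s0h tK]]]]].
  apply: contrapT => noi.
  have [|y|y [z [[i c] [ys zs yz]]]] := @pigeonhole _ _ s0
    [seq (i, c) | i <- enum 'I_N, c <- t]
    (fun y p => exists2 u, K u & w p.1 u = y /\ mdist p.2 u < h / 2) us0.
  - by rewrite size_allpairs size_enum_ord.
  - move=> ys; have [Ky xy] := s0K _ ys; have [i _ [u Ku wuy]] := Kw _ Ky.
    have [|c ct cu] := tK _ Ku.
      rewrite leNgt; apply/negP => xu; apply: noi; exists i; first by rewrite mem_enum.
      by exists u; rewrite ?wuy.
    exists (i, c); last by exists u.
    by apply/allpairsP; exists (i, c); rewrite mem_enum.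
  move=> [u Ku [wu cu]] [v Kv [wv cv]]; have := s0h _ _ ys zs yz.
  rewrite -wu -wv; have := w1 i _ _ Ku Kv; have := metric_triangle u c v.
  by move: cu cv => /=; rewrite (metric_sym u c); lra.
(* With more centres than maps, two share [w i]. Then [u] and [v] are at least [2 eta - 2 r >= eta]
   apart, yet [w i] shortens their distance by at most [4 r < eps]. *)
have [|x [y [i [xs ys xy [u Ku [xu xwu]] [v Kv [yv ywv]]]]]] := pigeonhole us _ recur.
  by rewrite size_enum_ord.
have := sep _ _ xs ys xy; rewrite mulr2n => etaxy.
have xuvy := metric_triangle x u y; have uvy := metric_triangle u v y.
have uxv := metric_triangle u x v; have xyv := metric_triangle x y v.
have xwy := metric_triangle x (w i u) y.
have wuwvy := metric_triangle (w i u) (w i v) y.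
rewrite (metric_sym u x) in uxv; rewrite (metric_sym v y) in uvy.
rewrite (metric_sym (w i v) y) in wuwvy.
have /(weps i _ _ Ku Kv) : eta <= mdist u v by lra.
lra.
Qed.

(** * Nowhere dense families of compact sets *)

Lemma distinct_or_finite (K : set X) n :
  (exists s, [/\ uniq s, size s = n & {in s, forall x, K x}]) \/
  (exists2 s, (size s <= n)%N & forall x, K x -> x \in s).
Proof.
elim: n => [|n [[s [us sn sK]]|[s sn Ks]]]; first by left; exists [::].
  have [Ks|/existsNP[x /not_implyP[Kx xs]]] := pselect (forall x, K x -> x \in s).
    by right; exists s; rewrite // sn.
  left; exists (x :: s); split=> /=; rewrite ?sn //; first by rewrite us andbT; apply/negP.
  by move=> y; rewrite inE => /orP[/eqP->|/sK].
by right; exists s => //; apply: leq_trans sn _.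
Qed.

(** One cluster suffices: as [t] is nonempty, a crowded set has more than [N] points. *)
Lemma nowhere_dense_finite N : isolated [set: X] = set0 ->
  nowhere_dense [set K : hyperspace X |
    exists2 s, (size s <= N)%N & forall x, hset K x -> x \in s].
Proof.
move=> Xni; apply: nowhere_dense_hyperspace => K e _ e0.
have [x Kx] := hset_neq0 K; have e20 : 0 < e / 2 by lra.
have [|F sF KF] := @near_finite_net _ _ K [:: x] _ _ e20.
  by move=> y; rewrite inE => /eqP->.
have xF : x \in F by apply/sF/mem_head.
have [F' [d [FF' hF d0 crow]]] := crowded_near N Xni xF ltr01 e20.
exists F', d; split=> //; first by case: F' FF' {hF crow} => // /(_ x xF).
  by rewrite [e]splitr; exact: hnear_trans KF hF.
move=> L [s sN Ls] /crow[s0 [t [h [[us0 t0 sz] [s0K _ _]]]]].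
suff : (N < N)%N by rewrite ltnn.
apply: leq_trans sN; apply: leq_trans (uniq_leq_size us0 _); last first.
  by move=> y /s0K[Ly _]; exact: Ls.
by apply: leq_ltn_trans sz; exact: leq_pmulr.
Qed.

Lemma nowhere_dense_contractive_cover N (eta eps : R) :
  isolated [set: X] = set0 -> 0 < eta -> 0 < eps ->
  nowhere_dense [set K : hyperspace X | contractive_cover N eta eps K /\
    exists s, [/\ uniq s, (N < size s)%N, separated (eta *+ 2) s &
      {in s, forall x, hset K x}]].
Proof.
move=> Xni eta0 eps0; apply: nowhere_dense_hyperspace => K e [_ [s [us Ns ss sK]]] e0.
have e20 : 0 < e / 2 by lra.
have [F sF KF] := near_finite_net sK e20.
(* [eps / 5] because the radius must be strictly below [eps / 4]. *)
have r0 : 0 < Num.min (eta / 2) (eps / 5) by rewrite lt_min; apply/andP; split; lra.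
have [F' [d [FF' hF d0 crow]]] := crowded_near_seq N Xni sF r0 e20.
exists F', d; split=> //.
- case: s Ns sF {us ss sK crow} => // x s _ sF.
  by case: F' FF' {hF} => // /(_ x); rewrite in_nil => /(_ (sF _ (mem_head _ _))).
- by rewrite [e]splitr; exact: hnear_trans KF hF.
move=> L [Lc _] /crow; apply: contractive_cover_not_crowded Lc _ _ us Ns ss.
  by rewrite ge_min lexx.
by apply: le_lt_trans (_ : _ <= eps / 5) _; [rewrite ge_min lexx orbT | lra].
Qed.

End WeakContractions.

(** * Countable cover of the set of attractors *)

Theorem theorem4p2 (R : realType) (X : metricType R)
  (Xcomplete : complete_space X) (Xseparable : separable_space X)
  (Xno_isolated : isolated [set: X] = set0) :
  meager [set A : hyperspace X |
    exists (n : nat) (w : 'I_n.+1 -> X -> X),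
      weakly_contractive w /\ is_attractor w A].
Proof.
pose inv k : R := k.+1%:R^-1.
have inv_gt0 k : 0 < inv k by rewrite invr_gt0.
pose G (i : nat + nat * nat * nat) : set (hyperspace X) := match i with
  | inl N => [set K : hyperspace X |
      exists2 s : seq X, (size s <= N)%N & forall x, hset K x -> x \in s]
  | inr (N, p, q) =>
      [set K : hyperspace X | contractive_cover N (inv p) (inv q) K /\
        exists s : seq X, [/\ uniq s, (N < size s)%N, separated (inv p *+ 2) s &
          {in s, forall x, hset K x}]]
  end.
apply: (@meager_countable_cover _ _ G) => [[N|[[N p] q]]|A [n [w [cw [wc [wA _]]]]]].
- exact: nowhere_dense_finite.
- exact: nowhere_dense_contractive_cover.
(* There are [n.+1] maps, so [n.+2] points are one more than the maps. *)
have [[s [us sn sA]]|fA] := distinct_or_finite A n.+2; last by exists (inl n.+2).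
have [m m0 ms] := separated_exists s.
have m20 : 0 < m / 2 by lra.
(* Half of [m], since the points must be [2 * inv p] apart. *)
have [p] := ltr_add_invr m20; rewrite add0r => pm.
have ew := weakly_contractive_edelstein cw.
have [q wq] := edelstein_gap wc ew (@hset_compact _ _ A) (inv_gt0 p).
exists (inr (n.+1, p, q)) => //; split.
  exists w; split=> //.
    by move=> x; rewrite -{1}wA.
  move=> i x y _ _; have [->|/eqP/(ew i)/ltW//] := eqVneq x y.
  by rewrite !mdistxx.
exists s; split=> //; first by rewrite sn.
move=> x y xs ys xy; apply: le_trans (ms _ _ xs ys xy).
by rewrite mulr2n [m]splitr lerD // ltW.
Qed.
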